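(* Let $\Gamma=\{\sim_{(1,1)},\sim_{(2,2)}\}$. The problem $\mathrm{DataSat}(\mathrm{rdFO}^{3},2,\Gamma)$ is undecidable: there is no algorithm that, given a finite set $\Sigma$ of unary predicate symbols and a sentence $\varphi\in\mathrm{rdFO}[2,\Sigma,\Gamma,3]$, decides whether some $2$-data structure over $\Sigma$ satisfies $\varphi$.
   Context: Let $\Sigma$ be a finite set of unary predicate symbols and $D\ge 0$ an integer. A $D$-data structure over $\Sigma$ is a tuple $\mathfrak{A}=(A,(P_\sigma)_{\sigma\in\Sigma},f_1,\dots,f_D)$ with $A$ a nonempty finite set, $P_\sigma\subseteq A$, and $f_1,\dots,f_D:A\to\mathbb{N}$; $\mathrm{Data}(D,\Sigma)$ is the set of these. For $i,j\in\{1,\dots,D\}$, $\sim_{(i,j)}$ is the binary relation symbol interpreted by $a\sim_{(i,j)}b$ iff $f_i(a)=f_j(b)$. For a set $\Gamma$ of such symbols, $\mathrm{dFO}[D,\Sigma,\Gamma]$ is first-order logic with atoms $\sigma(x)$, $x\sim y$ ($\sim\in\Gamma$), $x=y$, closed under $\vee,\neg,\exists$, with standard semantics. Data graph (relative to $\Gamma$): vertices $A\times\{1,\dots,D\}$, directed edge from $(a,i)$ to $(b,j)$ iff either $a=b$ and $i\neq j$, or $\sim_{(i,j)}\in\Gamma$ and $f_i(a)=f_j(b)$; distance = length of shortest directed path. $B_r(a)$ = set of vertices $(b,j)$ at distance $\le r$ from $(a,i)$ for some $i$. The $r$-view $\mathfrak{A}|^r_a$ has universe $\{b:(b,i)\in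 B_r(a)\text{ for some }i\}$, restricted unary predicates, and $i$-th data value of $b$ equal to $f_i(b)$ if $(b,i)\in B_r(a)$, else a fresh value (pairwise distinct, not among data values of $\mathfrak{A}$). $\mathrm{rdFO}[D,\Sigma,\Gamma,r]$: $\varphi::=\langle\psi\rangle^r_x\mid x=y\mid\exists x.\varphi\mid\varphi\vee\varphi\mid\neg\varphi$, $\psi\in\mathrm{dFO}[D,\Sigma,\Gamma]$ with at most $x$ free, and $\mathfrak{A}\models_I\langle\psi\rangle^r_x$ iff $\mathfrak{A}|^r_{I(x)}\models_I\psi$. $\mathrm{DataSat}(\mathrm{rdFO}^r,D,\Gamma)$: given finite $\Sigma$ and a sentence $\varphi\in\mathrm{rdFO}[D,\Sigma,\Gamma,r]$, is there $\mathfrak{A}\in\mathrm{Data}(D,\Sigma)$ with $\mathfrak{A}\models\varphi$? *)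

(* Defs.v *)
From mathcomp Require Import all_boot.

Set Implicit Arguments.
Unset Strict Implicit.
Unset Printing Implicit Defensive.

Record dataStr (D : nat) (Sigma : finType) := DataStr {
  univ :> finType;
  univ_gt0 : 0 < #|univ|;
  upred : Sigma -> {set univ};
  dval : 'I_D -> univ -> nat }.

(* Variables are natural numbers, bound by name. The data indices 1, ..., D
   become 0, ..., D.-1, and the symbol ~_(i,j) is identified with the pair
   (i, j). *)

Inductive dFO (D : nat) (Sigma : finType) (Gamma : {set 'I_D * 'I_D}) : Type :=
| DPred (s : Sigma) (x : nat)
| DSim (i j : 'I_D) of (i, j) \in Gamma & nat & nat
| DEq (x y : nat)
| DOr (p q : dFO Sigma Gamma)
| DNot (p : dFO Sigma Gamma)
| DEx (x : nat) (p : dFO Sigma Gamma).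

Section DFO.
Variables (D : nat) (Sigma : finType) (Gamma : {set 'I_D * 'I_D}).

Fixpoint dfv (p : dFO Sigma Gamma) : seq nat :=
  match p with
  | DPred _ x => [:: x]
  | DSim _ _ _ x y => [:: x; y]
  | DEq x y => [:: x; y]
  | DOr p q => dfv p ++ dfv q
  | DNot p => dfv p
  | DEx x p => [seq y <- dfv p | y != x]
  end.

Fixpoint dsat (A : dataStr D Sigma) (I : nat -> A) (p : dFO Sigma Gamma) :
    bool :=
  match p with
  | DPred s x => I x \in upred A s
  | DSim i j _ x y => dval i (I x) == dval j (I y)
  | DEq x y => I x == I y
  | DOr p q => dsat I p || dsat I q
  | DNot p => ~~ dsat I p
  | DEx x p => [exists a : A, dsat [eta I with x |-> a] p]
  end.

Definition dedge (A : dataStr D Sigma) : rel (A * 'I_D) := fun u v =>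
  (u.1 == v.1) && (u.2 != v.2)
  || ((u.2, v.2) \in Gamma) && (dval u.2 u.1 == dval v.2 v.1).

Definition dist_le (A : dataStr D Sigma) (r : nat) (u v : A * 'I_D) : bool :=
  [exists n : 'I_r.+1, exists p : n.-tuple (A * 'I_D)%type,
     path (@dedge A) u p && (last u p == v)].

Definition dball (A : dataStr D Sigma) (r : nat) (a : A) : {set A * 'I_D} :=
  [set v | [exists i, dist_le r (a, i) v]].

(* For D > 0 the center already belongs to the projection of the ball; adding
   it explicitly keeps the universe nonempty in the degenerate case D = 0. *)
Definition view_dom (A : dataStr D Sigma) (r : nat) (a : A) : {set A} :=
  a |: [set v.1 | v in dball r a].

Definition view_univ (A : dataStr D Sigma) (r : nat) (a : A) : finType :=
  {b : A | b \in view_dom r a}.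

Definition view_center (A : dataStr D Sigma) (r : nat) (a : A) :
  view_univ r a := Sub a (setU11 a _).

Lemma view_univ_gt0 (A : dataStr D Sigma) (r : nat) (a : A) :
  0 < #|view_univ r a|.
Proof. by apply/card_gt0P; exists (view_center r a). Qed.

(* Larger than every data value of A, and injective in (b, i). *)
Definition fresh_val (A : dataStr D Sigma) (b : A) (i : 'I_D) : nat :=
  (\max_(v : A * 'I_D) dval v.2 v.1).+1 + enum_rank (b, i).

Definition view (A : dataStr D Sigma) (r : nat) (a : A) : dataStr D Sigma :=
  {| univ := view_univ r a;
     univ_gt0 := view_univ_gt0 r a;
     upred := fun s => [set b | val b \in upred A s];
     dval := fun i b => if (val b, i) \in dball r a then dval i (val b)
                        else fresh_val (val b) i |}.

End DFO.

Inductive rdFO (D : nat) (Sigma : finType) (Gamma : {set 'I_D * 'I_D})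
    (r : nat) : Type :=
| RLoc (x : nat) (p : dFO Sigma Gamma) of all (pred1 x) (dfv p)
| REq (x y : nat)
| REx (x : nat) (p : rdFO Sigma Gamma r)
| ROr (p q : rdFO Sigma Gamma r)
| RNot (p : rdFO Sigma Gamma r).

Section RDFO.
Variables (D : nat) (Sigma : finType) (Gamma : {set 'I_D * 'I_D}) (r : nat).

Fixpoint rfv (p : rdFO Sigma Gamma r) : seq nat :=
  match p with
  | RLoc x _ _ => [:: x]
  | REq x y => [:: x; y]
  | REx x p => [seq y <- rfv p | y != x]
  | ROr p q => rfv p ++ rfv q
  | RNot p => rfv p
  end.

(* In the local case the values of I outside the view are replaced by its
   center; this is harmless, since only x, which denotes the center, may occur
   free in the local formula. *)
Fixpoint rsat (A : dataStr D Sigma) (I : nat -> A) (p : rdFO Sigma Gamma r) :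
    bool :=
  match p with
  | RLoc x p _ =>
      @dsat D Sigma Gamma (view Gamma r (I x))
        (fun y => insubd (view_center Gamma r (I x)) (I y)) p
  | REq x y => I x == I y
  | REx x p => [exists a : A, rsat [eta I with x |-> a] p]
  | ROr p q => rsat I p || rsat I q
  | RNot p => ~~ rsat I p
  end.

End RDFO.

(* Predicate symbols are drawn from the countable supply [nat]; a finite set of
   symbols is presented by a list of its elements. *)

Record dataSatInstance (D : nat) (Gamma : {set 'I_D * 'I_D}) (r : nat) :=
  DataSatInstance {
    inst_sig : seq nat;
    inst_form : rdFO (seq_sub inst_sig) Gamma r;
    inst_sentence : rfv inst_form == [::] }.

Definition DataSat (D : nat) (Gamma : {set 'I_D * 'I_D}) (r : nat)
    (w : dataSatInstance Gamma r) : Prop :=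
  exists A : dataStr D (seq_sub (inst_sig w)),
    forall I : nat -> A, rsat I (inst_form w).

(* Goedel numbering is based on Cantor's pairing function. *)
Definition npair (m n : nat) : nat := 'C((m + n).+1, 2) + n.

Fixpoint code_seq (s : seq nat) : nat :=
  if s is x :: s' then (npair x (code_seq s')).+1 else 0.

Section Codes.
Variables (D : nat) (Sigma : finType) (Gamma : {set 'I_D * 'I_D}) (r : nat).
Variable name : Sigma -> nat.

Fixpoint code_dFO (p : dFO Sigma Gamma) : nat :=
  match p with
  | DPred s x => npair 0 (npair (name s) x)
  | DSim i j _ x y => npair 1 (npair (npair i j) (npair x y))
  | DEq x y => npair 2 (npair x y)
  | DOr p q => npair 3 (npair (code_dFO p) (code_dFO q))
  | DNot p => npair 4 (code_dFO p)
  | DEx x p => npair 5 (npair x (code_dFO p))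
  end.

Fixpoint code_rdFO (p : rdFO Sigma Gamma r) : nat :=
  match p with
  | RLoc x p _ => npair 0 (npair x (code_dFO p))
  | REq x y => npair 1 (npair x y)
  | REx x p => npair 2 (npair x (code_rdFO p))
  | ROr p q => npair 3 (npair (code_rdFO p) (code_rdFO q))
  | RNot p => npair 4 (code_rdFO p)
  end.

End Codes.

Definition code_instance (D : nat) (Gamma : {set 'I_D * 'I_D}) (r : nat)
    (w : dataSatInstance Gamma r) : nat :=
  npair (code_seq (inst_sig w)) (code_rdFO val (inst_form w)).

(* No information is lost in the Goedel numbers: an instance is determined by
   its code. *)

Lemma npair_inj m n m' n' : npair m n = npair m' n' -> m = m' /\ n = n'.
Proof.
have lt k l a b : a + b = k -> k < l -> 'C(k.+1, 2) + b < 'C(l.+1, 2).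
  move=> <- ltkl; have le_l : 'C((a + b).+2, 2) <= 'C(l.+1, 2).
    by apply: leq_bin2l; rewrite ltnS.
  apply: leq_trans le_l; rewrite [X in _ < X]binS bin1 ltn_add2l ltnS.
  exact: leq_addl.
rewrite /npair => e; have es : m + n = m' + n'.
  case: (ltngtP (m + n) (m' + n')) => // h.
    have := lt _ _ m n erefl h.
    by rewrite e ltnNge leq_addr.
  have := lt _ _ m' n' erefl h.
  by rewrite -e ltnNge leq_addr.
move: e; rewrite es => /addnI en; split=> //.
by move: es; rewrite en => /addIn.
Qed.

Lemma code_seq_inj : injective code_seq.
Proof.
by elim=> [|x s IHs] [|y t] //= [] /npair_inj [-> /IHs ->].
Qed.

Lemma code_dFO_inj D (Sigma : finType) (Gamma : {set 'I_D * 'I_D})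
  (name : Sigma -> nat) :
  injective name -> injective (@code_dFO D Sigma Gamma name).
Proof.
move=> inj_name.
elim=> [s x|i j ij x y|x y|p IHp q IHq|p IHp|x p IHp]
       [s' x'|i' j' ij' x' y'|x' y'|p' q'|p'|x' p'] /= /npair_inj [] //= _.
- by case/npair_inj=> /inj_name -> ->.
- case/npair_inj=> /npair_inj [/val_inj ei /val_inj ej] /npair_inj [-> ->].
  by subst i' j'; rewrite (bool_irrelevance ij ij').
- by case/npair_inj=> -> ->.
- by case/npair_inj=> /IHp -> /IHq ->.
- by move=> /IHp ->.
- by case/npair_inj=> -> /IHp ->.
Qed.

Lemma code_rdFO_inj D (Sigma : finType) (Gamma : {set 'I_D * 'I_D}) r
  (name : Sigma -> nat) :
  injective name -> injective (@code_rdFO D Sigma Gamma r name).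
Proof.
move=> inj_name.
elim=> [x p xp|x y|x p IHp|p IHp q IHq|p IHp]
       [x' p' xp'|x' y'|x' p'|p' q'|p'] /= /npair_inj [] //= _.
- case/npair_inj=> ex /(code_dFO_inj inj_name) ep.
  by subst x' p'; rewrite (bool_irrelevance xp xp').
- by case/npair_inj=> -> ->.
- by case/npair_inj=> -> /IHp ->.
- by case/npair_inj=> /IHp -> /IHq ->.
- by move=> /IHp ->.
Qed.

Lemma code_instance_inj D (Gamma : {set 'I_D * 'I_D}) r :
  injective (@code_instance D Gamma r).
Proof.
move=> [S p hp] [S' p' hp'] /npair_inj [/= /code_seq_inj eS].
subst S' => /(code_rdFO_inj val_inj) ep; subst p'.
by rewrite (bool_irrelevance hp hp').
Qed.

Inductive recfun : nat -> Type :=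
| FZero n : recfun n
| FSucc : recfun 1
| FProj n (i : 'I_n) : recfun n
| FComp n k (f : recfun k) (gs : 'I_k -> recfun n) : recfun n
| FPrec n (f : recfun n) (g : recfun n.+2) : recfun n.+1
| FMin n (f : recfun n.+1) : recfun n.

(* [reval f v y]: the partial function denoted by f is defined at v, with value
   y. The sequence s in the case of primitive recursion lists the intermediate
   values; minimization requires all values below the zero to be defined. *)
Fixpoint reval n (f : recfun n) : n.-tuple nat -> nat -> Prop :=
  match f in recfun n return n.-tuple nat -> nat -> Prop with
  | FZero _ => fun _ y => y = 0
  | FSucc => fun v y => y = (thead v).+1
  | FProj _ i => fun v y => y = tnth v i
  | FComp _ k f gs => fun v y =>
      exists2 w : k.-tuple nat,
        forall i, reval (gs i) v (tnth w i) & reval f w y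
  | FPrec _ f g => fun v y =>
      exists s : nat -> nat,
        [/\ reval f [tuple of behead v] (s 0),
            forall m, m < thead v ->
              reval g [tuple of [:: m, s m & behead v]] (s m.+1)
          & y = s (thead v)]
  | FMin _ f => fun v y =>
      reval f [tuple of y :: v] 0 /\
      forall m, m < y -> exists k, reval f [tuple of m :: v] k.+1
  end.

(* No condition is imposed on numbers that are not codes of instances. *)
Definition rec_decidable (X : Type) (code : X -> nat) (P : X -> Prop) : Prop :=
  exists f : recfun 1, forall x : X,
    (P x -> reval f [tuple code x] 1) /\ (~ P x -> reval f [tuple code x] 0).

(* Main.v *)
(* The formula [exists x. <psi>_x] with [psi] a closed dFO formula is satisfiable
   as soon as [psi] holds in a structure in which any f_1-class meets any
   f_2-class, because 3-views in such a structure are everything; conversely a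
   view satisfying [psi] is itself a structure satisfying [psi]. So it is enough
   to work with dFO on finite structures with two equivalence relations. There a
   labelled element is a pair (f_1-class, f_2-class), so that labels are
   arbitrary binary relations on the elements of a marked "diagonal".

   With a strict linear order and relations for coded pairs and sets, the graph
   of a partial recursive function h has a first-order description that is sound
   in every finite linear order, and is true in the standard model on
   {0, ..., M-1} once M is large. Hence "h(n) = 0" becomes a sentence
   [chi_h /\ x0 = n]. If f decided satisfiability, take for h the function that
   maps n to f(code of the sentence [p /\ x0 = n]), where p is the formula with
   code n, and let n be the code of chi_h: the resulting sentence is satisfiable
   iff f rejects it. As h only manipulates codes, no universal machine is
   needed. *)
Require Import Defs.
From mathcomp Require Import all_boot.

Set Implicit Arguments.
Unset Strict Implicit.
Unset Printing Implicit Defensive.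

(** * Recursive functions *)

Lemma reval_inj n (f : recfun n) v y y' :
  reval f v y -> reval f v y' -> y = y'.
Proof.
elim: f v y y' => [k||k i|k l f IHf gs IHgs|k f IHf g IHg|k f IHf] v y y' /=.
- by move=> -> ->.
- by move=> -> ->.
- by move=> -> ->.
- move=> [w Hw Hf] [w' Hw' Hf']; apply: (IHf w) => //.
  suff -> : w = w' by [].
  by apply: eq_from_tnth => i; apply: (IHgs i v).
- move=> [s [s0 sS ->]] [s' [s0' sS' ->]].
  suff H m : m <= thead v -> s m = s' m by apply: H.
  elim: m => [|m IHm] lt_m; first exact: IHf s0 s0'.
  have := sS' m lt_m; rewrite -IHm ?(ltnW lt_m) // => H'.
  exact: IHg (sS m lt_m) H'.
- move=> [Hy Ly] [Hy' Ly'].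
  case: (ltngtP y y') => // lt.
    by have [z /(IHf _ _ _ Hy)] := Ly' _ lt.
  by have [z /(IHf _ _ _ Hy')] := Ly _ lt.
Qed.

(** Determinism of [g] forces the intermediate tuple to be [[tuple y]], while [f] may be partial. *)
Lemma reval_comp1 (f g : recfun 1) (v : 1.-tuple nat) y z : reval g v y ->
  reval (FComp f (fun _ : 'I_1 => g)) v z <-> reval f [tuple y] z.
Proof.
move=> gy; split=> [[u gu fu]|fz]; last by exists [tuple y] => // i; rewrite ord1.
suff -> : [tuple y] = u by [].
by apply: eq_from_tnth => i; rewrite ord1; apply: reval_inj (gu ord0).
Qed.

Definition computable n (F : n.-tuple nat -> nat) : Prop :=
  exists f : recfun n, forall v, reval f v (F v).

Lemma computable_proj n (i : 'I_n) : computable (fun v => tnth v i).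
Proof. by exists (FProj i). Qed.

Lemma computable_comp n k (F : k.-tuple nat -> nat)
    (G : 'I_k -> n.-tuple nat -> nat) :
  computable F -> (forall i, computable (G i)) ->
  computable (fun v => F [tuple G i v | i < k]).
Proof.
move=> [f Hf] /fin_all_exists [gs Hgs]; exists (FComp f gs) => v /=.
by exists [tuple G i v | i < k] => // i; rewrite tnth_mktuple.
Qed.

Lemma computable_comp1 n F (G : n.-tuple nat -> nat) :
  computable (fun v : 1.-tuple nat => F (thead v)) -> computable G ->
  computable (fun v => F (G v)).
Proof.
move=> cF cG; have [f Hf] := computable_comp cF (fun=> cG).
by exists f => v; have := Hf v; rewrite /thead tnth_mktuple.
Qed.

Lemma computable_comp2 n F (G H : n.-tuple nat -> nat) :
  computable (fun v : 2.-tuple nat => F (tnth v ord0) (tnth v ord_max)) ->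
  computable G -> computable H -> computable (fun v => F (G v) (H v)).
Proof.
move=> cF cG cH.
have cGH (i : 'I_2) : computable (if i == ord0 then G else H) by case: eqP.
have [f Hf] := computable_comp cF cGH.
by exists f => v; have := Hf v; rewrite !tnth_mktuple.
Qed.

Lemma computable_prec n (F : nat -> n.-tuple nat -> nat) :
  computable (F 0) ->
  (exists2 G : n.+2.-tuple nat -> nat, computable G &
    forall m v, F m.+1 v = G [tuple of [:: m, F m v & v]]) ->
  computable (fun v : n.+1.-tuple nat => F (thead v) [tuple of behead v]).
Proof.
move=> [f Hf] [G [g Hg] FS]; exists (FPrec f g) => v /=.
exists (fun m => F m [tuple of behead v]); split=> // m _.
by rewrite FS; apply: Hg.
Qed.

Lemma computable_succ n (F : n.-tuple nat -> nat) :
  computable F -> computable (fun v => (F v).+1).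
Proof. by apply: computable_comp1; exists FSucc. Qed.

Lemma computable_const n c : computable (fun _ : n.-tuple nat => c).
Proof. by elim: c => [|c /computable_succ //]; exists (FZero n). Qed.

Lemma computable_add n (F G : n.-tuple nat -> nat) :
  computable F -> computable G -> computable (fun v => F v + G v).
Proof.
apply: computable_comp2.
have [||f Hf] := @computable_prec 1 (fun m v => m + thead v).
- exact: computable_proj.
- exists (fun v => (tnth v (inord 1)).+1); last first.
    by move=> m v; rewrite (tnth_nth 0) /= inordK.
  exact/computable_succ/computable_proj.
exists f => v; have := Hf v; congr (reval _ _ (_ + _)).
by rewrite /thead !(tnth_nth 0) /= nth_behead.
Qed.

Lemma computable_npair n (F G : n.-tuple nat -> nat) :
  computable F -> computable G -> computable (fun v => npair (F v) (G v)).
Proof.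
move=> cF cG; apply: computable_add => //.
apply: (@computable_comp1 _ (fun m => 'C(m.+1, 2))); last exact: computable_add.
have [||f Hf] := @computable_prec 0 (fun m v => 'C(m.+1, 2)).
- exact: computable_const.
(* Pascal's rule C(m+2, 2) = C(m+1, 2) + (m+1); index 0 holds the counter m and index 1 the previous
   value. *)
- exists (fun v => tnth v (inord 1) + (tnth v ord0).+1).
    apply: computable_add; first exact: computable_proj.
    exact/computable_succ/computable_proj.
  by move=> m v; rewrite !(tnth_nth 0) /= inordK //= binS bin1.
by exists f.
Qed.

Lemma computable_iter n c (K : nat -> nat) (F : n.-tuple nat -> nat) :
  computable (fun v : 1.-tuple nat => K (thead v)) -> computable F ->
  computable (fun v => iter (F v) K c).
Proof.
move=> cK; apply: (@computable_comp1 _ (fun m => iter m K c)).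
have [||f Hf] := @computable_prec 0 (fun m v => iter m K c).
- exact: computable_const.
- exists (fun v => K (tnth v ord_max)); last by move=> m v; rewrite (tnth_nth 0).
  by apply: computable_comp1 => //; apply: computable_proj.
by exists f.
Qed.

(** * Arithmetic in data structures *)

Section Semantics.
Variables (T : finType) (dom : {set T}) (R : nat -> rel T).

Definition is_zero (a : T) := [forall b in dom, ~~ R 1 b a].

Definition is_succ (a b : T) :=
  R 1 a b && [forall c in dom, ~~ (R 1 a c && R 1 c b)].

(* [t] is a code of a finite set of pairs, one of which is [(m, a)]. *)
Definition has_entry (t m a : T) :=
  [exists c in dom, [&& R 2 c m, R 3 c a & R 4 c t]].

(* A primitive recursion is witnessed by a set [t] of pairs (argument, value)
   each of which is justified by its predecessor in [t]; in a finite linear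
   order this descent terminates, so [t] need not even be functional. *)
Fixpoint sem n (f : recfun n) (xs : seq T) (y : T) : bool :=
  match f with
  | FZero _ => is_zero y
  | FSucc => is_succ (head y xs) y
  | FProj _ i => y == nth y xs i
  | FComp _ k f gs =>
      [exists ws : k.-tuple T, all (mem dom) ws &&
        ([forall i, sem (gs i) xs (nth y ws i)] && sem f ws y)]
  | FPrec _ f g =>
      [exists t in dom, has_entry t (head y xs) y &&
        [forall m in dom, [forall a in dom, has_entry t m a ==>
          is_zero m && sem f (behead xs) a
          || [exists m' in dom, [exists a' in dom, [&& is_succ m' m,
               has_entry t m' a' & sem g [:: m', a' & behead xs] a]]]]]]
  | FMin _ f =>
      [exists m in dom, is_zero m && sem f (y :: xs) m] &&
      [forall m in dom, R 1 m y ==>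
        [exists k in dom, ~~ is_zero k && sem f (m :: xs) k]]
  end.

Definition strict_order :=
  [forall a in dom, ~~ R 1 a a && [forall b in dom,
    ((a == b) || (R 1 a b || R 1 b a)) &&
    [forall c in dom, R 1 a b && R 1 b c ==> R 1 a c]]].

End Semantics.

(* 0 marks the elements that stand for numbers; 1 to 4 mark the pairs in the
   order, in the two projections, and in the membership relation. *)
Definition signature : seq nat := iota 0 5.

(** Total in [k], so that formulas carry no membership proofs; numbers outside the signature fall
    back on 0. *)
Definition sym (k : nat) : seq_sub signature :=
  insubd (SeqSub (mem_head 0 (iota 1 4))) k.

Definition upd (T : Type) (I : nat -> T) x a : nat -> T :=
  fun y => if y == x then a else I y.

Lemma upd_same T (I : nat -> T) x a : upd I x a x = a.
Proof. by rewrite /upd eqxx. Qed.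

Lemma upd_lt T (I : nat -> T) x a y : y < x -> upd I x a y = I y.
Proof. by rewrite /upd => /ltn_eqF ->. Qed.

Lemma map_upd T (I : nat -> T) x a s :
  all (gtn x) s -> map (upd I x a) s = map I s.
Proof. by move/allP=> H; apply/eq_in_map => y /H lt_y; apply: upd_lt. Qed.

Fixpoint upds (T : Type) (I : nat -> T) x (ws : seq T) : nat -> T :=
  if ws is w :: ws' then upds (upd I x w) x.+1 ws' else I.

Lemma upds_lt T (I : nat -> T) x ws y : y < x -> upds I x ws y = I y.
Proof.
elim: ws I x => //= w ws IHws I x lt_yx.
by rewrite IHws ?upd_lt // ltnW.
Qed.

Lemma map_upds T (I : nat -> T) x ws s :
  all (gtn x) s -> map (upds I x ws) s = map I s.
Proof. by move/allP=> H; apply/eq_in_map => y /H lt_y; apply: upds_lt. Qed.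

Lemma map_upds_iota T (I : nat -> T) x ws :
  map (upds I x ws) (iota x (size ws)) = ws.
Proof.
elim: ws I x => //= w ws IHws I x.
by rewrite IHws upds_lt // upd_same.
Qed.

Lemma head_map (T S : Type) (h : T -> S) y s : head (h y) (map h s) = h (head y s).
Proof. by case: s. Qed.

Lemma nth_map_default (T S : Type) (h : T -> S) y s i :
  nth (h y) (map h s) i = h (nth y s i).
Proof. by elim: s i => [|x s IHs] [|i] //=. Qed.

(** * First-order definitions of the graphs of recursive functions *)

Section Formulas.
Variable Gamma : {set 'I_2 * 'I_2}.
Hypotheses (h0 : (ord0, ord0) \in Gamma) (h1 : (ord_max, ord_max) \in Gamma).

Local Notation formula := (@dFO 2 (seq_sub signature) Gamma).
Local Notation structure := (dataStr 2 (seq_sub signature)).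

Definition DAnd (p q : formula) : formula := DNot (DOr (DNot p) (DNot q)).
Definition DImp (p q : formula) : formula := DOr (DNot p) q.
Definition DExN x (p : formula) : formula := DEx x (DAnd (DPred Gamma (sym 0) x) p).
Definition DAllN x (p : formula) : formula := DNot (DExN x (DNot p)).
Definition DExNs x k (p : formula) : formula := foldr DExN p (iota x k).

(** The bound variable [(x + y).+1] is a cheap choice distinct from both arguments; the same device
    recurs below. *)
Definition DRel k x y : formula :=
  let z := (x + y).+1 in
  DEx z (DAnd (DPred Gamma (sym k) z)
    (DAnd (DSim (seq_sub signature) h0 z x) (DSim (seq_sub signature) h1 z y))).

Definition DZero x : formula := DAllN x.+1 (DNot (DRel 1 x.+1 x)).

Definition DSucc x y : formula :=
  let z := (x + y).+1 in
  DAnd (DRel 1 x y) (DAllN z (DNot (DAnd (DRel 1 x z) (DRel 1 z y)))).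

Definition DEntry t m a : formula :=
  let z := (t + m + a).+1 in
  DExN z (DAnd (DRel 2 z m) (DAnd (DRel 3 z a) (DRel 4 z t))).

Definition DOrder : formula :=
  DAllN 1 (DAnd (DNot (DRel 1 1 1)) (DAllN 2 (DAnd
    (DOr (DEq _ _ 1 2) (DOr (DRel 1 1 2) (DRel 1 2 1)))
    (DAllN 3 (DImp (DAnd (DRel 1 1 2) (DRel 1 2 3)) (DRel 1 1 3)))))).

(* The formula for the graph of [f] at the variables [xs] and [y], with bound
   variables taken from [z] on. *)
Fixpoint DGraph n (f : recfun n) (xs : seq nat) (y z : nat) : formula :=
  match f with
  | FZero _ => DZero y
  | FSucc => DSucc (head y xs) y
  | FProj _ i => DEq _ _ y (nth y xs i)
  | FComp _ k f gs =>
      DExNs z k (DAnd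
        (foldr DAnd (DEq _ _ y y)
          [seq DGraph (gs i) xs (z + i) (z + k) | i <- enum 'I_k])
        (DGraph f (iota z k) y (z + k)))
  | FPrec _ f g =>
      DExN z (DAnd (DEntry z (head y xs) y)
        (DAllN z.+1 (DAllN z.+2 (DImp (DEntry z z.+1 z.+2)
          (DOr (DAnd (DZero z.+1) (DGraph f (behead xs) z.+2 z.+3))
            (DExN z.+3 (DExN z.+4 (DAnd (DSucc z.+3 z.+1)
               (DAnd (DEntry z z.+3 z.+4)
                  (DGraph g [:: z.+3, z.+4 & behead xs] z.+2 z.+4.+1))))))))))
  | FMin _ f =>
      DAnd (DExN z (DAnd (DZero z) (DGraph f (y :: xs) z z.+1)))
        (DAllN z (DImp (DRel 1 z y)
          (DExN z.+1 (DAnd (DNot (DZero z.+1)) (DGraph f (z :: xs) z.+1 z.+2)))))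
  end.

Section Sat.
Variable A : structure.

Definition numbers : {set A} := upred A (sym 0).

Definition drel k : rel A := fun a b =>
  [exists c in upred A (sym k), (dval ord0 c == dval ord0 a)
                             && (dval ord_max c == dval ord_max b)].

Implicit Types (I : nat -> A) (p q : formula).

Lemma dsat_Not I p : dsat I (DNot p) = ~~ dsat I p.
Proof. by []. Qed.

Lemma dsat_Or I p q : dsat I (DOr p q) = dsat I p || dsat I q.
Proof. by []. Qed.

Lemma dsat_Ex I x p : dsat I (DEx x p) = [exists a, dsat (upd I x a) p].
Proof. by []. Qed.

Lemma dsat_And I p q : dsat I (DAnd p q) = dsat I p && dsat I q.
Proof. by rewrite /= negb_or !negbK. Qed.

Lemma dsat_Imp I p q : dsat I (DImp p q) = (dsat I p ==> dsat I q).
Proof. by rewrite implybE. Qed.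

Lemma dsat_ExN I x p :
  dsat I (DExN x p) = [exists a in numbers, dsat (upd I x a) p].
Proof.
rewrite [LHS]/=; apply: eq_existsb => a.
by rewrite negb_or !negbK eqxx.
Qed.

Lemma dsat_AllN I x p :
  dsat I (DAllN x p) = [forall a in numbers, dsat (upd I x a) p].
Proof.
rewrite dsat_Not dsat_ExN negb_exists.
by apply: eq_forallb => a; rewrite dsat_Not negb_and negbK implybE.
Qed.

Lemma dsat_ExNs I x k p :
  dsat I (DExNs x k p) =
  [exists ws : k.-tuple A, all (mem numbers) ws && dsat (upds I x ws) p].
Proof.
elim: k x I => [|k IHk] x I.
  apply/idP/existsP => [sat_p|[ws]]; first by exists [tuple].
  by rewrite tuple0 /=.
rewrite [LHS]dsat_ExN; apply/exists_inP/existsP.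
  case=> a Na; rewrite [dsat _ _]IHk => /existsP[ws /andP[Nws sat_p]].
  by exists [tuple of a :: ws]; rewrite /= Na Nws.
case; case/tupleP=> a ws /= /andP[/andP[Na Nws] sat_p]; exists a => //.
by rewrite [dsat _ _]IHk; apply/existsP; exists ws; rewrite Nws.
Qed.

Lemma dsat_Rel I k x y : dsat I (DRel k x y) = drel k (I x) (I y).
Proof.
rewrite [LHS]/=; apply: eq_existsb => a; rewrite !negb_or !negbK eqxx.
have /ltn_eqF -> : x < (x + y).+1 by rewrite ltnS leq_addr.
by have /ltn_eqF -> : y < (x + y).+1 by rewrite ltnS leq_addl.
Qed.

Lemma dsat_Zero I x : dsat I (DZero x) = is_zero numbers drel (I x).
Proof.
rewrite dsat_AllN; apply: eq_forallb => a.
by rewrite dsat_Not dsat_Rel upd_same upd_lt.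
Qed.

Lemma dsat_Succ I x y : dsat I (DSucc x y) = is_succ numbers drel (I x) (I y).
Proof.
rewrite dsat_And dsat_Rel dsat_AllN; congr (_ && _); apply: eq_forallb => a.
rewrite dsat_Not dsat_And !dsat_Rel upd_same.
by rewrite !upd_lt // ltnS ?leq_addl ?leq_addr.
Qed.

Lemma dsat_Entry I t m a :
  dsat I (DEntry t m a) = has_entry numbers drel (I t) (I m) (I a).
Proof.
rewrite dsat_ExN; apply: eq_existsb => c.
rewrite !dsat_And !dsat_Rel upd_same.
rewrite !upd_lt // ltnS -?addnA ?leq_addr // addnC -addnA ?leq_addr //.
by rewrite addnC -addnA leq_addr.
Qed.

Lemma dsat_Order I : dsat I DOrder = strict_order numbers drel.
Proof.
rewrite dsat_AllN; apply: eq_forallb => a; congr (_ ==> _).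
rewrite dsat_And dsat_Not dsat_Rel upd_same.
congr (_ && _); rewrite dsat_AllN; apply: eq_forallb => b; congr (_ ==> _).
rewrite dsat_And; congr (_ && _).
  by rewrite !dsat_Or !dsat_Rel.
rewrite dsat_AllN; apply: eq_forallb => c; congr (_ ==> _).
by rewrite dsat_Imp dsat_And !dsat_Rel.
Qed.

Lemma dsat_bigAnd I y s :
  dsat I (foldr DAnd (DEq _ _ y y) s) = all (dsat I) s.
Proof.
elim: s => [|p s IHs]; first by rewrite /= eqxx.
by rewrite [LHS]dsat_And IHs.
Qed.

Lemma all_gtn_leq x y s : x <= y -> all (gtn x) s -> all (gtn y) s.
Proof. by move=> le_xy; apply: sub_all => z lt_zx; apply: leq_trans le_xy. Qed.

(** No capture occurs: the binders of [DGraph] itself start at [z], above all free variables, and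
    those of the auxiliary formulas exceed their own arguments. *)
Lemma dsat_Graph n (f : recfun n) I xs y z :
  all (gtn z) xs -> y < z ->
  dsat I (DGraph f xs y z) = sem numbers drel f (map I xs) (I y).
Proof.
elim: f I xs y z => [k||k i|k l f IHf gs IHgs|k f IHf g IHg|k f IHf]
  I xs y z lt_xs lt_y.
- exact: dsat_Zero.
- by rewrite [LHS]dsat_Succ /= head_map.
- by rewrite /= nth_map_default.
- rewrite [LHS]dsat_ExNs; apply: eq_existsb => ws; congr (_ && _).
  have lt_s m s : all (gtn z) s -> all (gtn (z + m)) s.
    by apply: all_gtn_leq; apply: leq_addr.
  (* The block of [l] variables from [z] on carries the intermediate values [ws]. *)
  have J_iota : map (upds I z ws) (iota z l) = ws.
    by rewrite -[in iota z l](size_tuple ws) map_upds_iota.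
  have Jy : upds I z ws y = I y by rewrite upds_lt.
  rewrite dsat_And dsat_bigAnd IHf ?J_iota ?Jy; first last.
  + by rewrite ltn_addr.
  + by apply/allP=> i; rewrite mem_iota => /andP[].
  congr (_ && _); rewrite all_map.
  have H i : dsat (upds I z ws) (DGraph (gs i) xs (z + i) (z + l)) =
             sem numbers drel (gs i) (map I xs) (nth (I y) ws i).
    rewrite IHgs ?lt_s ?ltn_add2l // map_upds //; congr sem.
    rewrite -[RHS](congr1 (fun s => nth (I y) s i) J_iota).
    by rewrite (nth_map 0) ?size_iota // nth_iota.
  apply/allP/forallP => [Hall i|Hall i _]; last by rewrite /= H; apply: Hall.
  by have /= := Hall i; rewrite H mem_enum; apply.
- rewrite [LHS]dsat_ExN; apply: eq_existsb => t; congr (_ && _).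
  have lt_bxs : all (gtn z) (behead xs) by case: (xs) lt_xs => //= ? ? /andP[].
  have lt_hd : head y xs < z by case: (xs) lt_xs => //= ? ? /andP[].
  have lt_s m : all (gtn (m + z)) (behead xs).
    by apply: all_gtn_leq lt_bxs; apply: leq_addl.
  rewrite dsat_And dsat_Entry upd_same !upd_lt // -head_map; congr (_ && _).
  rewrite dsat_AllN; apply: eq_forallb => m; congr (_ ==> _).
  rewrite dsat_AllN; apply: eq_forallb => a; congr (_ ==> _).
  rewrite dsat_Imp dsat_Entry !(upd_same, upd_lt) //.
  congr (_ ==> _); rewrite dsat_Or dsat_And dsat_Zero IHf //; last exact: (lt_s 3).
  rewrite upd_same upd_lt // upd_same !map_upd ?behead_map //; last first.
  + exact: (lt_s 2).
  + exact: (lt_s 1).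
  congr (_ || _); rewrite dsat_ExN.
  apply: eq_existsb => m'; congr (_ && _).
  rewrite dsat_ExN.
  apply: eq_existsb => a'; congr (_ && _).
  rewrite dsat_And dsat_Succ dsat_And dsat_Entry IHg /=; first last.
  + exact: leqW (leqnSn _).
  + by rewrite !ltnS leqnSn leqnn; exact: (lt_s 5).
  rewrite !map_upd //; [|exact: (lt_s 1)|exact: (lt_s 2)|exact: (lt_s 3)|exact: (lt_s 4)].
  by rewrite !(upd_same, upd_lt) //; do ?[exact: leqnn | apply: leqW].
- rewrite [LHS]dsat_And dsat_ExN dsat_AllN; congr (_ && _).
    apply: eq_existsb => m; congr (_ && _).
    rewrite dsat_And dsat_Zero IHf //=; last first.
      by rewrite ltnS ltnW //=; apply: all_gtn_leq lt_xs.
    by rewrite map_upd // upd_same upd_lt.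
  apply: eq_forallb => m; congr (_ ==> _).
  rewrite dsat_Imp dsat_Rel upd_same upd_lt //; congr (_ ==> _).
  rewrite dsat_ExN; apply: eq_existsb => k'; congr (_ && _).
  rewrite dsat_And dsat_Not dsat_Zero IHf //=; last first.
    by rewrite ltnS leqnSn; apply: all_gtn_leq lt_xs; rewrite -addn2 leq_addr.
  rewrite !map_upd //; last by apply: all_gtn_leq lt_xs.
  by rewrite upd_same upd_lt // upd_same.
Qed.

End Sat.
End Formulas.

(** * Soundness and completeness *)

Section Soundness.
Variables (T : finType) (dom : {set T}) (R : nat -> rel T).
Hypothesis R_order : strict_order dom R.

(** The number that [a] stands for: an arbitrary finite model is compared with the natural numbers
    through [rank]. *)
Definition rank (a : T) := #|[set b in dom | R 1 b a]|.

Lemma order_irr a : a \in dom -> R 1 a a = false.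
Proof. by move=> Da; move/forall_inP/(_ a Da): R_order => /andP[/negbTE]. Qed.

Lemma order_total a b : a \in dom -> b \in dom -> a != b -> R 1 a b || R 1 b a.
Proof.
move=> Da Db neq_ab; move/forall_inP/(_ a Da): R_order.
by case/andP=> _ /forall_inP/(_ b Db); rewrite (negbTE neq_ab) => /andP[].
Qed.

Lemma order_trans a b c : a \in dom -> b \in dom -> c \in dom ->
  R 1 a b -> R 1 b c -> R 1 a c.
Proof.
move=> Da Db Dc Rab Rbc; move/forall_inP/(_ a Da): R_order.
case/andP=> _ /forall_inP/(_ b Db)/andP[_] /forall_inP/(_ c Dc).
by rewrite Rab Rbc.
Qed.

Lemma rank_zero a : is_zero dom R a = (rank a == 0).
Proof.
rewrite cards_eq0; apply/forall_inP/eqP => [no_lt|a0 b Db].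
  by apply/setP=> b; rewrite !inE; apply/andP=> -[/no_lt/negP].
by apply: contraFN (in_set0 b) => lt_ba; rewrite -a0 inE Db.
Qed.

Lemma rank_succ a b :
  a \in dom -> b \in dom -> is_succ dom R a b -> rank b = (rank a).+1.
Proof.
move=> Da Db /andP[Rab /forall_inP nbtw].
suff e : [set c in dom | R 1 c b] = a |: [set c in dom | R 1 c a].
  by rewrite /rank e cardsU1 inE order_irr // andbF.
apply/setP=> c; rewrite !inE; case: eqP => [->|/eqP neq_ca]; first by rewrite Da.
case Dc: (c \in dom) => //=; apply/idP/idP => [Rcb|Rca].
  have /orP[//|Rac] := order_total Dc Da neq_ca.
  by have := nbtw _ Dc; rewrite Rac Rcb.
exact: order_trans Rca Rab.
Qed.

Lemma rank_lt a b : a \in dom -> b \in dom -> R 1 a b -> rank a < rank b.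
Proof.
move=> Da Db Rab; apply/proper_card/properP; split.
  apply/subsetP=> c; rewrite !inE => /andP[Dc Rca].
  by rewrite Dc; apply: order_trans Rca Rab.
by exists a; rewrite !inE ?Da // order_irr.
Qed.

Lemma rank_inj : {in dom &, injective rank}.
Proof.
move=> a b Da Db e; apply/eqP; apply/idPn => /(order_total Da Db).
by case/orP=> [/(rank_lt Da Db)|/(rank_lt Db Da)]; rewrite e ltnn.
Qed.

(** Pigeonhole: the [rank b] elements below [b] have distinct ranks smaller than [rank b], hence
    take all these values. *)
Lemma rank_onto b n :
  b \in dom -> n < rank b -> exists2 a, a \in dom & R 1 a b /\ rank a = n.
Proof.
move=> Db lt_n; pose below := enum [set a in dom | R 1 a b].
have below_dom a : a \in below -> a \in dom /\ R 1 a b.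
  by rewrite mem_enum inE => /andP[].
have sz : size below = rank b by rewrite -cardE.
have [|||_ mem_rank] := @uniq_min_size _ [seq rank a | a <- below] (iota 0 (rank b)).
- rewrite map_inj_in_uniq ?enum_uniq // => a c /below_dom[Da _] /below_dom[Dc _].
  exact: rank_inj.
- move=> _ /mapP[a /below_dom[Da Rab] ->].
  by rewrite mem_iota rank_lt.
- by rewrite size_iota size_map sz.
have : n \in [seq rank a | a <- below] by rewrite mem_rank mem_iota.
by case/mapP=> a /below_dom[Da Rab] ->; exists a.
Qed.

(** Only relation 1 is constrained; relations 2 to 4 are arbitrary, so tables may have spurious
    entries. Still, every justified entry descends to argument 0, and this descent spells out a
    genuine computation. *)
Lemma sem_sound n (f : recfun n) xs y (v : n.-tuple nat) :
  all (mem dom) xs -> y \in dom -> map rank xs = v ->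
  sem dom R f xs y -> reval f v (rank y).
Proof.
elim: f xs y v => [k||k i|k l f IHf gs IHgs|k f IHf g IHg|k f IHf]
  xs y v Dxs Dy ev.
- by rewrite /= rank_zero => /eqP.
- move=> Sxy; case/tupleP: v ev Sxy => x v /=; rewrite theadE.
  by case: xs Dxs => //= a xs /andP[Da _] [<- _] /(rank_succ Da Dy).
- move=> /= /eqP ->; rewrite (tnth_nth (rank y)) -ev.
  by rewrite nth_map_default.
- case/existsP=> ws /andP[Dws /andP[/forallP Hg Hf]].
  exists [tuple of map rank ws]; last exact: IHf Hf.
  move=> i; rewrite tnth_map (tnth_nth y).
  apply: IHgs (Hg i) => //; apply: (allP Dws).
  by rewrite mem_nth // size_tuple.
- case/tupleP: v ev => x v; case: xs Dxs => //= a xs /andP[Da Dxs] [ex exs].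
  case/exists_inP=> t Dt /andP[Tay /forall_inP HT].
  have Hbehead : tval [tuple of behead [tuple of x :: v]] = map rank xs by rewrite exs.
  (* Induction on the rank [j] of the argument, for all entries at once, since [t] may give one
     argument several values. *)
  have H j m b : rank m = j -> m \in dom -> b \in dom -> has_entry dom R t m b ->
    exists s : nat -> nat,
      [/\ reval f [tuple of behead [tuple of x :: v]] (s 0),
          forall i, i < j -> reval g [tuple of [:: i, s i & behead [tuple of x :: v]]] (s i.+1)
        & rank b = s j].
    elim: j m b => [|j IHj] m b em Dm Db Tmb.
      have /forall_inP/(_ b Db) := HT m Dm; rewrite Tmb /=.
      case/orP=> [/andP[_ Hf]|]; first by exists (fun=> rank b); split=> //; apply: IHf Hf.
      case/exists_inP=> m' Dm' /exists_inP[a' _ /and3P[/(rank_succ Dm' Dm)]].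
      by rewrite em.
    have /forall_inP/(_ b Db) := HT m Dm; rewrite Tmb /= rank_zero em /=.
    case/exists_inP=> m' Dm' /exists_inP[a' Da' /and3P[/(rank_succ Dm' Dm)]].
    rewrite em => -[em'] Ta' Hg.
    have [s [s0 sS sj]] := IHj m' a' (esym em') Dm' Da' Ta'.
    (* The computation behind the predecessor entry is prolonged by one value, at [j.+1]. *)
    exists (fun i => if i <= j then s i else rank b); rewrite leq0n ltnn; split=> // i.
    rewrite ltnS => le_ij; rewrite le_ij; case: ltngtP le_ij => // [lt_ij|eq_ij] _.
      exact: sS.
    by apply: IHg Hg => //=; rewrite ?Dm' ?Da' // exs eq_ij -sj em'.
  rewrite theadE; have [s [s0 sS ->]] := H x a y ex Da Dy Tay.
  by exists s.
- case/andP=> /exists_inP[z Dz /andP[]]; rewrite rank_zero => /eqP ez Hf /forall_inP Hm.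
  split; first by rewrite -ez; apply: IHf Hf; rewrite /= ?Dy ?ev.
  (* The formula searches over elements, minimization over numbers: each number below [rank y] is
     the rank of some element. *)
  move=> m /(rank_onto Dy)[b Db [Rby eb]].
  have := Hm b Db; rewrite Rby => /exists_inP[c Dc /andP[]].
  rewrite rank_zero -lt0n => /prednK ec Hc; exists (rank c).-1.
  by rewrite ec; apply: IHf Hc; rewrite /= ?Db ?eb ?ev.
Qed.

End Soundness.

(* Numbers double as codes: 2 and 3 are the two projections of a coded pair, 4
   is membership in a coded list. *)
Definition std_rel (k i j : nat) : bool :=
  match k with
  | 0 => i == j
  | 1 => i < j
  | 2 => omap fst (unpickle i : option (nat * nat)) == Some j
  | 3 => omap snd (unpickle i : option (nat * nat)) == Some j
  | _ => i \in odflt [::] (unpickle j : option (seq nat))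
  end.

(** Stated through an enumeration [e] rather than for a fixed carrier, because it will be applied to
    views, whose universes are subtypes. *)
Definition standard M (T : finType) (dom : {set T}) (R : nat -> rel T) (e : nat -> T) :=
  (forall a, a \in dom <-> exists2 i, i < M & a = e i) /\
  (forall k i j, i < M -> j < M -> k < 5 -> R k (e i) (e j) = std_rel k i j).

(** Completeness holds only for large [M]: intermediate values and codes of tables must themselves
    be numbers of the model. *)
Definition eventually (P : nat -> Prop) := exists m, forall M, m <= M -> P M.

Lemma eventually_and P Q :
  eventually P -> eventually Q -> eventually (fun M => P M /\ Q M).
Proof.
move=> [m Pm] [n Qn]; exists (maxn m n) => M; rewrite geq_max => /andP[leM leN].
by split; [apply: Pm | apply: Qn].
Qed.

Lemma eventually_impl (P Q : nat -> Prop) :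
  (forall M, P M -> Q M) -> eventually P -> eventually Q.
Proof. by move=> PQ [m Pm]; exists m => M /Pm /PQ. Qed.

Lemma eventually_lt n : eventually (fun M => n < M).
Proof. by exists n.+1. Qed.

Lemma eventually_all_lt n (P : nat -> nat -> Prop) :
  (forall i, i < n -> eventually (P i)) ->
  eventually (fun M => forall i, i < n -> P i M).
Proof.
elim: n => [|n IHn] HP; first by exists 0.
have HPn : eventually (P n) by apply: HP.
have {}IHn := IHn (fun i lt_in => HP i (ltnW lt_in)).
apply: eventually_impl (eventually_and HPn IHn) => M [Pn Plt] i.
by rewrite ltnS leq_eqVlt => /predU1P[->|/Plt].
Qed.

Section Standard.
Variables (M : nat) (T : finType) (dom : {set T}) (R : nat -> rel T) (e : nat -> T).
Hypothesis stdR : standard M dom R e.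

Lemma standard_dom i : i < M -> e i \in dom.
Proof. by move=> lt_i; apply/stdR.1; exists i. Qed.

Lemma standard_zero i : i < M -> is_zero dom R (e i) = (i == 0).
Proof.
case: stdR => domE RE lt_i; apply/forall_inP/eqP => [H|-> a].
  apply/eqP; rewrite -leqn0 leqNgt; apply/negP=> i_gt0.
  have lt0M : 0 < M by apply: leq_trans lt_i.
  by have := H _ (standard_dom lt0M); rewrite RE //= i_gt0.
by case/domE=> j lt_j ->; rewrite RE //=; apply: leq_trans lt_j.
Qed.

Lemma standard_succ i j :
  i < M -> j < M -> is_succ dom R (e i) (e j) = (j == i.+1).
Proof.
case: stdR => domE RE lt_i lt_j; apply/andP/eqP => [[]|ej].
  rewrite RE //= => lt_ij /forall_inP H; apply/eqP; rewrite eqn_leq lt_ij andbT leqNgt.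
  apply/negP=> lt_Sij; have lt_Si : i.+1 < M by apply: ltn_trans lt_j.
  by have := H _ (standard_dom lt_Si); rewrite !RE //= ltnSn lt_Sij.
subst j; rewrite RE //= ltnSn; split=> //; apply/forall_inP=> a /domE[j lt_jM ->].
by rewrite !RE //= ltnS ltnNge andNb.
Qed.

Lemma standard_order : strict_order dom R.
Proof.
case: stdR => domE RE; apply/forall_inP=> a /domE[i lt_i ->].
rewrite RE //= ltnn; apply/forall_inP=> b /domE[j lt_j ->].
rewrite !RE //=; apply/andP; split; first by case: ltngtP => [||->]; rewrite ?orbT ?eqxx.
apply/forall_inP=> c /domE[k lt_k ->]; rewrite !RE //=.
by apply/implyP=> /andP[]; apply: ltn_trans.
Qed.

Lemma standard_entryP t i j : t < M -> i < M -> j < M ->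
  reflect (exists2 c, c < M & unpickle c = Some (i, j) /\
             c \in odflt [::] (unpickle t : option (seq nat)))
    (has_entry dom R (e t) (e i) (e j)).
Proof.
case: stdR => domE RE lt_t lt_i lt_j; apply: (iffP exists_inP).
  case=> a /domE[c lt_c ->]; rewrite !RE //= => /and3P[e1 e2 ct]; exists c => //.
  by split=> //; case: unpickle e1 e2 => // -[i' j'] /= /eqP[->] /eqP[->].
case=> c lt_c [ec ct]; exists (e c); first exact: standard_dom.
by rewrite !RE //= ec /= !eqxx.
Qed.

End Standard.

(** A converging computation involves finitely many numbers, and so do the tables that code it; any
    [M] above all of them works. *)
Lemma sem_complete n (f : recfun n) (v : n.-tuple nat) y :
  reval f v y ->
  eventually (fun M => forall T (dom : {set T}) R e, standard M dom R e ->
    sem dom R f (map e v) (e y)).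
Proof.
elim: f v y => [k||k i|k l f IHf gs IHgs|k f IHf g IHg|k f IHf] v y.
- move=> /= ->; apply: eventually_impl (eventually_lt 0) => M lt_M T dom R e stdR.
  by rewrite (standard_zero stdR).
- case/tupleP: v => x v /=; rewrite theadE => ->.
  apply: eventually_impl (eventually_lt x.+1) => M lt_M T dom R e stdR.
  by rewrite /= (standard_succ stdR (ltnW lt_M) lt_M) eqxx.
- move=> /= ->; exists 0 => M _ T dom R e stdR.
  by rewrite /= nth_map_default {1}(tnth_nth (tnth v i)) eqxx.
- case=> w Hg Hf.
  (* Restated over natural numbers below [l] to fit [eventually_all_lt]; the ordinal is rebuilt from
     the bound. *)
  have Hg' : forall i, i < l -> eventually (fun M => nth 0 w i < M /\
      forall lt_il : i < l, forall T (dom : {set T}) R e, standard M dom R e ->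
        sem dom R (gs (Ordinal lt_il)) (map e v) (e (nth 0 w i))).
    move=> i lt_il; have := IHgs _ _ _ (Hg (Ordinal lt_il)); rewrite (tnth_nth 0) /= => Hi.
    apply: eventually_impl (eventually_and (eventually_lt (nth 0 w i)) Hi) => M [lt_M HM].
    by split=> // lt_il'; rewrite (bool_irrelevance lt_il' lt_il).
  apply: eventually_impl (eventually_and (eventually_all_lt Hg') (IHf _ _ Hf)).
  move=> M [HgM HfM] T dom R e stdR; apply/existsP; exists [tuple of map e w].
  apply/andP; split.
    apply/allP=> _ /mapP[j /(nthP 0)[i lt_i <-] ->].
    apply: (standard_dom stdR); apply: (HgM i _).1.
    by rewrite size_tuple in lt_i.
  apply/andP; split; last exact: HfM.
  apply/forallP=> -[i lt_il] /=; rewrite (nth_map 0) ?size_tuple //.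
  exact: (HgM i lt_il).2.
- case/tupleP: v => x v /= [s]; rewrite theadE => -[s0 sS ->].
  (* The table [t] codes the graph of [s] on 0, ..., [x], each [c i] being one entry; all these
     codes must lie below [M]. *)
  pose c i := pickle (i, s i); pose t := pickle [seq c i | i <- iota 0 x.+1].
  have Hs : forall i, i < x.+1 -> eventually (fun M => s i < M /\ c i < M).
    by move=> i _; apply: eventually_and; apply: eventually_lt.
  have HgM := eventually_all_lt (fun i lt_i => IHg _ _ (sS i lt_i)).
  apply: eventually_impl (eventually_and (eventually_and (eventually_lt x) (eventually_lt t))
    (eventually_and (eventually_all_lt Hs) (eventually_and (IHf _ _ s0) HgM))).
  move=> M {Hs HgM IHf IHg} [[lt_x lt_t] [lt_s [Hf Hg]]] T dom R e stdR.
  have behead_e : map e (behead (x :: v)) = map e v by [].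
  apply/exists_inP; exists (e t); first exact: (standard_dom stdR).
  have entryP i j : i < M -> j < M ->
      reflect (i <= x /\ j = s i) (has_entry dom R (e t) (e i) (e j)).
    move=> lt_i lt_j; apply: (iffP (standard_entryP stdR lt_t lt_i lt_j)).
      case=> d lt_d [ed]; rewrite /t pickleK /= => d_t.
      have /mapP[i' ] : d \in [seq c i | i <- iota 0 x.+1] by [].
      rewrite mem_iota => /= lt_i' eD; move: ed; rewrite eD pickleK => -[<- <-].
      by split.
    case=> le_ix ->; exists (c i); first by apply: (lt_s i _).2.
    split; first by rewrite pickleK.
    by rewrite /t pickleK; apply: map_f; rewrite mem_iota.
  have lt_sM i : i <= x -> s i < M by move=> le_i; apply: (lt_s i _).1.
  apply/andP; split; first by apply/entryP => //; apply: lt_sM.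
  apply/forall_inP=> a /stdR.1[i lt_i ->]; apply/forall_inP=> b /stdR.1[j lt_j ->].
  apply/implyP=> /entryP-/(_ lt_i lt_j)[le_ix ->].
  case: i => [|i] in lt_i le_ix *; first by rewrite (standard_zero stdR) ?Hf.
  apply/orP; right; have lt_iM := ltnW lt_i.
  apply/exists_inP; exists (e i); first exact: (standard_dom stdR).
  apply/exists_inP; exists (e (s i)); first exact/(standard_dom stdR)/lt_sM/ltnW.
  rewrite (standard_succ stdR) // eqxx /=; apply/andP; split.
    by apply/entryP; rewrite ?lt_sM // ?(ltnW le_ix).
  exact: (Hg i le_ix).
- case=> Hy Hm.
  have Hm' : forall m, m < y -> eventually (fun M => exists2 k, k.+1 < M &
      forall T (dom : {set T}) R e, standard M dom R e ->
        sem dom R f (map e (m :: v)) (e k.+1)).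
    move=> m /Hm[k' Hk'].
    apply: eventually_impl (eventually_and (eventually_lt k'.+1) (IHf _ _ Hk')).
    by move=> M [lt_M HM]; exists k'.
  apply: eventually_impl (eventually_and (eventually_lt y)
    (eventually_and (IHf _ _ Hy) (eventually_all_lt Hm'))).
  move=> M {Hm Hm' IHf} [lt_y [Hf Hm]] T dom R e stdR /=.
  have lt_0 : 0 < M by apply: leq_trans lt_y.
  apply/andP; split.
    apply/exists_inP; exists (e 0); first exact: (standard_dom stdR).
    by rewrite (standard_zero stdR) //=; apply: Hf.
  apply/forall_inP=> a /stdR.1[m lt_m ->]; rewrite stdR.2 //=.
  apply/implyP=> /Hm[k' lt_k Hk]; apply/exists_inP; exists (e k'.+1).
    exact: (standard_dom stdR).
  by rewrite (standard_zero stdR) //=; apply: Hk.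
Qed.

(** * The diagonal instance *)

Lemma val_sym k : k < 5 -> val (sym k) = k.
Proof. by move=> lt_k; rewrite /sym /= insubdK // [_ \in _]mem_iota. Qed.

(** * Grids, in which every 3-view is everything *)

Section Grid.
Variable N : nat.

Lemma grid_gt0 : 0 < #|{: 'I_N.+1 * 'I_N.+1}|.
Proof. by apply/card_gt0P; exists (ord0, ord0). Qed.

(* The element (i, j) plays the role of the ordered pair of numbers i and j: the
   diagonal represents the numbers, and the labels are binary relations. Since
   (a.1, b.2) links any a to any b, every 3-view is the whole structure. *)
Definition grid : dataStr 2 (seq_sub signature) :=
  {| univ := ('I_N.+1 * 'I_N.+1)%type;
     univ_gt0 := grid_gt0;
     upred := fun s => [set p : 'I_N.+1 * 'I_N.+1 | std_rel (val s) p.1 p.2];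
     dval := fun i (p : 'I_N.+1 * 'I_N.+1) => if i == ord0 then p.1 else p.2 |}.

Variable Gamma : {set 'I_2 * 'I_2}.
Hypotheses (h0 : (ord0, ord0) \in Gamma) (h1 : (ord_max, ord_max) \in Gamma).

Lemma grid_ball (a b : grid) i : (b, i) \in dball Gamma 3 a.
Proof.
rewrite inE; case: (eqVneq i ord0) => [->|i_neq0].
  (* Three edges suffice: along the second value from [a] to [c], across the two indices of [c],
     along the first value to [b]. *)
  pose c : grid := (b.1, a.2).
  apply/existsP; exists ord_max; apply/existsP; exists ord_max.
  apply/existsP; exists [tuple (c, ord_max); (c, ord0); (b, ord0)].
  by rewrite /= /dedge /= h0 h1 !eqxx !orbT.
have -> : i = ord_max by apply/val_inj; case: i i_neq0 => -[|[|]].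
pose c : grid := (a.1, b.2).
apply/existsP; exists ord0; apply/existsP; exists ord_max.
apply/existsP; exists [tuple (c, ord0); (c, ord_max); (b, ord_max)].
by rewrite /= /dedge /= h0 h1 !eqxx !orbT.
Qed.

Lemma grid_view_dom (a b : grid) : b \in view_dom Gamma 3 a.
Proof.
rewrite inE; apply/orP; right; apply/imsetP.
by exists (b, ord0); first exact: grid_ball.
Qed.

(** As the ball is everything, the view has all elements of the grid and no fresh values; only the
    subtype wrapping remains. *)
Lemma grid_view_standard (a : grid) :
  exists e, standard N.+1 (numbers (view Gamma 3 a)) (@drel (view Gamma 3 a)) e.
Proof.
pose g (p : grid) : view Gamma 3 a := Sub p (grid_view_dom a p).
(* The number i is the diagonal element (i, i). *)
exists (fun i => g (inord i, inord i)).
have valg p : val (g p) = p by [].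
have gval (b : view Gamma 3 a) : b = g (val b) by apply/val_inj.
have dvalE i (b : view Gamma 3 a) : dval i b = dval i (val b).
  by rewrite /= grid_ball.
split=> [b|k i j lt_i lt_j lt_k].
  rewrite !inE val_sym //=; split=> [/eqP e|[i lt_i ->]]; last by rewrite valg.
  exists (val b).1; first exact: ltn_ord.
  rewrite [LHS]gval [val b in LHS]surjective_pairing inord_val; congr (g (_, _)).
  exact/val_inj/esym.
apply/exists_inP/idP => [[c]|std_ij].
  rewrite !inE val_sym // !dvalE !valg /= !inordK // => std_c /andP[/eqP <- /eqP <-].
  exact: std_c.
(* The off-diagonal element (i, j) is the one that can carry a label relating i to j. *)
exists (g (inord i, inord j)); first by rewrite !inE val_sym //= !inordK.
by rewrite !dvalE !valg /= !eqxx.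
Qed.

End Grid.

(** * Halting sentences *)

Section Reduction.
Variable Gamma : {set 'I_2 * 'I_2}.
Hypotheses (h0 : (ord0, ord0) \in Gamma) (h1 : (ord_max, ord_max) \in Gamma).

Local Notation formula := (@dFO 2 (seq_sub signature) Gamma).
Local Notation structure := (dataStr 2 (seq_sub signature)).

(** Rebinding variable 0 at each level makes the formula for n+1 a fixed context around that for n,
    so its code is computed by plain iteration. *)
Fixpoint DNum n : formula :=
  if n is n'.+1 then
    DExN 1 (DAnd (DSucc h0 h1 1 0) (DExN 0 (DAnd (DEq _ _ 0 1) (DNum n'))))
  else DZero h0 h1 0.

Lemma dfv_Num n : [seq x <- dfv (DNum n) | x != 0] = [::].
Proof.
by elim: n => //= n ->.
Qed.

Lemma dsat_Num_rank (A : structure) (I : nat -> A) n :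
  strict_order (numbers A) (@drel A) -> I 0 \in numbers A -> dsat I (DNum n) ->
  rank (numbers A) (@drel A) (I 0) = n.
Proof.
move=> ordA; elim: n I => [|n IHn] I NI.
  by rewrite [DNum _]/= dsat_Zero rank_zero => /eqP.
rewrite [DNum _]/= dsat_ExN => /exists_inP[a Na]; rewrite dsat_And => /andP[].
rewrite dsat_Succ upd_same upd_lt // => /(rank_succ ordA Na NI) ->.
rewrite dsat_ExN => /exists_inP[b Nb]; rewrite dsat_And => /andP[/eqP eb /IHn].
by move: eb; rewrite /upd /= => -> ->.
Qed.

Lemma standard_Num M (A : structure) (e : nat -> A) (I : nat -> A) n :
  standard M (numbers A) (@drel A) e -> n < M -> I 0 = e n -> dsat I (DNum n).
Proof.
move=> stdA; elim: n I => [|n IHn] I lt_n I0.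
  by rewrite [DNum _]/= dsat_Zero I0 (standard_zero stdA).
have Nn := standard_dom stdA (ltnW lt_n).
rewrite [DNum _]/= dsat_ExN; apply/exists_inP; exists (e n) => //.
rewrite dsat_And dsat_Succ upd_same upd_lt // I0 (standard_succ stdA) ?(ltnW lt_n) //.
rewrite eqxx dsat_ExN; apply/exists_inP; exists (e n) => //.
by rewrite dsat_And IHn ?(ltnW lt_n) // andbT /= /upd.
Qed.

(* Quantifying away every free variable but 0 makes closedness syntactic, and
   is harmless: variable 0 is the only one whose value matters below. *)
Definition DClose (p : formula) : formula :=
  foldr (@DEx _ _ _) p [seq x <- dfv p | x != 0].

Lemma dfv_foldr_Ex (p : formula) s :
  dfv (foldr (@DEx _ _ _) p s) = [seq x <- dfv p | x \notin s].
Proof.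
elim: s => [|y s IHs] /=; first by rewrite filter_predT.
by rewrite IHs -filter_predI; apply: eq_filter => x; rewrite /= inE negb_or.
Qed.

Lemma dfv_Close (p : formula) : [seq x <- dfv (DClose p) | x != 0] = [::].
Proof.
rewrite dfv_foldr_Ex -filter_predI; apply/eqP; rewrite -[_ == _]negbK -has_filter.
by apply/hasPn=> x px; rewrite /= mem_filter px andbT; case: eqP.
Qed.

Lemma dsat_Close (A : structure) (I : nat -> A) p :
  dsat I (DClose p) -> exists2 J, J 0 = I 0 & dsat J p.
Proof.
have : 0 \notin [seq x <- dfv p | x != 0] by rewrite mem_filter eqxx.
rewrite /DClose; elim: (filter _ _) I => [|y s IHs] I; first by exists I.
rewrite inE negb_or => /andP[y_neq0 s0] /existsP[a /(IHs _ s0)[J J0 sat_J]].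
by exists J => //; rewrite J0 /= (negbTE y_neq0).
Qed.

Lemma dsat_Close_all (A : structure) (I : nat -> A) p :
  (forall J, J 0 = I 0 -> dsat J p) -> dsat I (DClose p).
Proof.
rewrite /DClose; elim: (filter _ _) I => [|y s IHs] I HI; first exact: HI.
(* The witness [I 0] leaves the value at 0 unchanged, whichever variable [y] is. *)
apply/existsP; exists (I 0); apply: IHs => J; rewrite /= if_same.
exact: HI.
Qed.

(** The input stays the free variable 0, so the code of this formula depends on [h] alone and can be
    fed to [h] as input. *)
Definition DHalt (h : recfun 1) : formula :=
  DClose (DAnd (DPred Gamma (sym 0) 0) (DAnd (DOrder h0 h1)
    (DExN 1 (DAnd (DZero h0 h1 1) (DGraph h0 h1 h [:: 0] 1 2))))).

Definition DHaltOn h n : formula := DEx 0 (DAnd (DHalt h) (DNum n)).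

Lemma dfv_HaltOn h n : dfv (DHaltOn h n) = [::].
Proof. by rewrite /= filter_cat dfv_Close dfv_Num. Qed.

Lemma dsat_HaltOn (A : structure) (I : nat -> A) h n :
  dsat I (DHaltOn h n) -> reval h [tuple n] 0.
Proof.
rewrite dsat_Ex => /existsP[a]; rewrite dsat_And => /andP[/dsat_Close[J J0]].
rewrite !dsat_And dsat_Order dsat_ExN => /and3P[NJ ordA /exists_inP[b Nb]].
rewrite dsat_And dsat_Zero upd_same rank_zero dsat_Graph // => /andP[/eqP b0 Hh].
move=> /(dsat_Num_rank ordA); rewrite /= -/(numbers A) -J0 => /(_ NJ) en.
have := sem_sound ordA _ _ _ Hh; rewrite upd_same b0; apply=> //=.
- by rewrite upd_lt // andbT; exact: NJ.
- by rewrite upd_lt // en.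
Qed.

Lemma standard_HaltOn (h : recfun 1) n : reval h [tuple n] 0 ->
  eventually (fun M => forall (A : structure) (e : nat -> A) (I : nat -> A),
    standard M (numbers A) (@drel A) e -> dsat I (DHaltOn h n)).
Proof.
move=> /sem_complete Hh; apply: eventually_impl (eventually_and (eventually_lt n) Hh).
move=> M [lt_n {}Hh] A e I stdA; rewrite dsat_Ex; apply/existsP; exists (e n).
rewrite dsat_And; apply/andP; split; last exact: (standard_Num stdA).
apply: dsat_Close_all => J; rewrite upd_same => J0.
rewrite !dsat_And dsat_Order (standard_order stdA).
have lt_0 : 0 < M by apply: leq_ltn_trans lt_n.
apply/and3P; split=> //; first by rewrite /= J0 (standard_dom stdA).
rewrite dsat_ExN; apply/exists_inP; exists (e 0); first exact: (standard_dom stdA).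
rewrite dsat_And dsat_Zero upd_same (standard_zero stdA) // dsat_Graph //=.
rewrite upd_same upd_lt // J0; exact: Hh.
Qed.

Lemma RHaltOn_local h n : all (pred1 0) (dfv (DHaltOn h n)).
Proof. by rewrite dfv_HaltOn. Qed.

Definition RHaltOn h n : rdFO (seq_sub signature) Gamma 3 :=
  REx 0 (RLoc 3 (RHaltOn_local h n)).

Definition halt_instance h n : dataSatInstance Gamma 3 :=
  @DataSatInstance 2 Gamma 3 signature (RHaltOn h n) isT.

Lemma DataSat_halt h n : DataSat (halt_instance h n) <-> reval h [tuple n] 0.
Proof.
split=> [[A satA]|/standard_HaltOn[M HM]].
  have /card_gt0P[a _] := univ_gt0 A.
  by have /existsP[b /dsat_HaltOn] := satA (fun=> a).
(* [grid M] has [M.+1] numbers, still past the threshold [M]. *)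
exists (grid M) => I; apply/existsP; exists (I 0).
have [e stdV] := grid_view_standard h0 h1 (I 0).
exact: HM (leqnSn M) _ _ _ stdV.
Qed.

(** * Computing codes of instances, and the diagonal argument *)

Local Notation code := (code_dFO (val : seq_sub signature -> nat)).

Definition code_And a b := npair 4 (npair 3 (npair (npair 4 a) (npair 4 b))).
Definition code_ExN x a :=
  npair 5 (npair x (code_And (code (DPred Gamma (sym 0) x)) a)).

Definition code_Num n :=
  iter n (fun a => code_ExN 1 (code_And (code (DSucc h0 h1 1 0))
            (code_ExN 0 (code_And (code (@DEq 2 (seq_sub signature) Gamma 0 1)) a))))
         (code (DZero h0 h1 0)).

(** After the signature, the constants are the tags and variables of [REx 0], [RLoc] at 0 and
    [DEx 0]; [c] stands for the code of [DHalt h]. *)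
Definition code_halt_instance c n :=
  npair (code_seq signature) (npair 2 (npair 0 (npair 0 (npair 0
    (npair 5 (npair 0 (code_And c (code_Num n)))))))).

(* Gödel numbers are far too large to be evaluated by conversion. *)
Local Opaque npair.

Lemma code_NumE n : code (DNum n) = code_Num n.
Proof.
elim: n => [|n IHn]; first exact: erefl.
rewrite /code_Num iterS -/(code_Num n) -IHn /code_ExN /code_And; exact: erefl.
Qed.

Lemma code_instanceE h n :
  code_instance (halt_instance h n) = code_halt_instance (code (DHalt h)) n.
Proof. rewrite /code_halt_instance -code_NumE; exact: erefl. Qed.

Lemma computable_And n (F G : n.-tuple nat -> nat) :
  computable F -> computable G -> computable (fun v => code_And (F v) (G v)).
Proof.
by move=> cF cG; do 4 ?apply: computable_npair => //; apply: computable_const.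
Qed.

Lemma computable_ExN n x (F : n.-tuple nat -> nat) :
  computable F -> computable (fun v => code_ExN x (F v)).
Proof.
move=> cF; do 2![apply: computable_npair; first exact: computable_const].
by apply: computable_And => //; apply: computable_const.
Qed.

Lemma computable_self :
  computable (fun v : 1.-tuple nat => code_halt_instance (thead v) (thead v)).
Proof.
have cid : computable (fun v : 1.-tuple nat => thead v) by apply: computable_proj.
do 7![apply: computable_npair; first exact: computable_const].
apply: computable_And => //; apply: computable_iter => //.
do 2![apply: computable_ExN; apply: computable_And; first exact: computable_const].
exact: cid.
Qed.

Lemma DataSat_undecidable :
  ~ rec_decidable (@code_instance 2 Gamma 3) (@DataSat 2 Gamma 3).
Proof.
case=> f f_dec; have [d Hd] := computable_self.
(* Self-reference: on the code of [DHalt h], [h] asks [f] about the instance stating that [h]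
   returns 0 on that very code. *)
pose h := FComp f (fun _ : 'I_1 => d); pose n := code (DHalt h).
pose w := halt_instance h n.
have dn : reval d [tuple n] (code_instance w).
  by have := Hd [tuple n]; rewrite theadE -code_instanceE.
have satP : DataSat w <-> reval h [tuple n] 0 by apply: DataSat_halt.
(* The code is abstracted to a variable [c], of which only [dn] is remembered. *)
have [] := f_dec w; move: (code_instance w) dn => c dn sat1 sat0.
have hP := reval_comp1 f 0 dn.
have unsat : ~ DataSat w.
  move=> sat; have fc0 : reval f [tuple c] 0 by apply/hP/satP.
  by have := reval_inj (sat1 sat) fc0.
(* If [w] is unsatisfiable, [f] answers 0, so [h] returns 0 on [n] and [w] is satisfiable after
   all. *)
exact/unsat/satP/hP/sat0.
Qed.

End Reduction.

Theorem theorem3p26 (Gamma : {set 'I_2 * 'I_2})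
  (hGamma : Gamma = [set (ord0, ord0); (ord_max, ord_max)]) :
  ~ rec_decidable (@code_instance 2 Gamma 3) (@DataSat 2 Gamma 3).
Proof. by apply: DataSat_undecidable; rewrite hGamma ?set21 ?set22. Qed.
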